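(* Let $\mathcal{S}[k]=(RLR)^kLR$ and $\mathcal{S}'[k]=(RLR)^kRR$. Let $\mu=1$, $\delta_R>1$, and $$\tau_L=-1+\frac{1}{\delta_R}-\frac{1}{\delta_R^2(\delta_R^2+1)},\qquad \delta_L=\frac{1}{\delta_R^2},\qquad \tau_R=-1-\delta_R.$$ Then for all $k\ge1$, the two-dimensional border-collision normal form $f$ with these parameter values has a unique, admissible, asymptotically stable $\mathcal{S}[k]$-cycle, and a unique, admissible, saddle-type $\mathcal{S}'[k]$-cycle.
   Context: The two-dimensional border-collision normal form is the continuous map $f:\mathbb{R}^2\to\mathbb{R}^2$, $f(x,y)=f^L(x,y)$ if $x\le 0$ and $f(x,y)=f^R(x,y)$ if $x\ge 0$, where for $J\in\{L,R\}$ $$f^J(x,y)=A_J\begin{bmatrix} x \\ y \end{bmatrix}+\begin{bmatrix} 1 \\ 0 \end{bmatrix}\mu,\qquad A_J=\begin{bmatrix} \tau_J & 1 \\ -\delta_J & 0 \end{bmatrix}.$$ A word in $\{L,R\}$ is identified with the periodic symbol sequence obtained by repeating it infinitely; powers and products of words denote concatenation. For a word $\mathcal{S}=\mathcal{S}_0\cdots\mathcal{S}_{n-1}$, let $M_{\mathcal{S}}=A_{\mathcal{S}_{n-1}}\cdots A_{\mathcal{S}_0}$. An $\mathcal{S}$-cycle is a tuple of points $(x_i,y_i)$, $i$ modulo $n$, with $(x_{i+1},y_{i+1})=f^{\mathcal{S}_i}(x_i,y_i)$ for all $i$. It is unique if and only if $\det(I-M_{\mathcal{S}})\neq0$. It is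 admissible if $x_i\le0$ whenever $\mathcal{S}_i=L$ and $x_i\ge0$ whenever $\mathcal{S}_i=R$; in that case it is a periodic solution of $f$. Asymptotically stable means asymptotically stable as a periodic solution of $f$. The eigenvalues of $M_{\mathcal{S}}$ are the stability multipliers of the $\mathcal{S}$-cycle; the cycle is of saddle-type if one multiplier has modulus less than $1$ and the other has modulus greater than $1$. *)

(* Defs.v *)
From mathcomp Require Import all_boot all_order all_algebra.
From mathcomp Require Import all_classical all_reals all_analysis.
From mathcomp Require Import complex.

Set Implicit Arguments.
Unset Strict Implicit.
Unset Printing Implicit Defensive.

Import Order.TTheory GRing.Theory Num.Theory.
Import numFieldNormedType.Exports.

Local Open Scope classical_set_scope.
Local Open Scope ring_scope.

Inductive symbol := symL | symR.

Definition word := seq symbol.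

Definition wpow (k : nat) (w : word) : word := flatten (nseq k w).

Definition word_S (k : nat) : word :=
  wpow k [:: symR; symL; symR] ++ [:: symL; symR].

Definition word_S' (k : nat) : word :=
  wpow k [:: symR; symL; symR] ++ [:: symR; symR].

Record bcnf_params (R : Type) := BcnfParams {
  tauL : R;
  deltaL : R;
  tauR : R;
  deltaR : R;
  mu : R
}.

Definition tau (R : Type) (P : bcnf_params R) (J : symbol) : R :=
  match J with symL => tauL P | symR => tauR P end.

Definition delta (R : Type) (P : bcnf_params R) (J : symbol) : R :=
  match J with symL => deltaL P | symR => deltaR P end.

Section BorderCollision.
Context {R : realType}.
Implicit Types (P : bcnf_params R) (J : symbol) (w : word) (z : 'cV[R]_2).

Definition vec2 (x y : R) : 'cV[R]_2 := \col_(i < 2) nth 0 [:: x; y] i.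

Definition xcoord z : R := z ord0 ord0.

Definition Amx P J : 'M[R]_2 :=
  \matrix_(i < 2, j < 2)
    nth 0 (nth [::] [:: [:: tau P J; 1]; [:: - delta P J; 0]] i) j.

Definition fpiece P J z : 'cV[R]_2 := Amx P J *m z + mu P *: vec2 1 0.

Definition bcnf P z : 'cV[R]_2 :=
  if xcoord z <= 0 then fpiece P symL z else fpiece P symR z.

(* The two pieces agree on the switching line x = 0, so giving that line to
   the left piece in [bcnf] is immaterial. *)
Lemma bcnf_right P z : 0 <= xcoord z -> bcnf P z = fpiece P symR z.
Proof.
move=> z_ge0; rewrite /bcnf; case: ifPn => // z_le0.
have z0 : xcoord z = 0 by apply/eqP; rewrite eq_le z_le0 z_ge0.
rewrite /fpiece; congr (_ + _); apply/matrixP => i j.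
rewrite (ord1 j) !mxE !big_ord_recl !big_ord0 -/(xcoord z) z0 !mulr0.
by rewrite !mxE; case: i => [[|[|i]] hi].
Qed.

(* M_S = A_{S_(n-1)} ... A_{S_0}: the first letter acts first. *)
Definition Mword P w : 'M[R]_2 :=
  foldl (fun (M : 'M[R]_2) J => Amx P J *m M) 1%:M w.

(* [ordS] is the successor modulo [size w]. *)
Definition is_cycle P w (p : {ffun 'I_(size w) -> 'cV[R]_2}) : Prop :=
  forall i, p (ordS i) = fpiece P (tnth (in_tuple w) i) (p i).

Definition admissible w (p : {ffun 'I_(size w) -> 'cV[R]_2}) : Prop :=
  forall i, match tnth (in_tuple w) i with
            | symL => xcoord (p i) <= 0
            | symR => 0 <= xcoord (p i)
            end.

Definition lyapunov_stable (f : 'cV[R]_2 -> 'cV[R]_2) (z0 : 'cV[R]_2) : Prop :=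
  forall e : R, 0 < e -> exists2 d : R, 0 < d &
    forall z, `|z - z0| < d ->
      forall t : nat, `|iter t f z - iter t f z0| < e.

Definition attracting (f : 'cV[R]_2 -> 'cV[R]_2) (z0 : 'cV[R]_2) : Prop :=
  exists2 d : R, 0 < d &
    forall z, `|z - z0| < d ->
      (fun t : nat => iter t f z - iter t f z0) @ \oo --> (0 : 'cV[R]_2).

(* Asymptotic stability, from every phase of the cycle, of the solution of
   [bcnf P] through it; for an admissible cycle that solution runs through
   the points of the cycle. *)
Definition asymptotically_stable P w (p : {ffun 'I_(size w) -> 'cV[R]_2}) :
    Prop :=
  forall i, lyapunov_stable (bcnf P) (p i) /\ attracting (bcnf P) (p i).

Definition multiplier P w (a : R[i]) : Prop :=
  eigenvalue (map_mx (real_complex R) (Mword P w)) a.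

(* The strict inequalities make a and b distinct, so they are the two
   eigenvalues of the 2 x 2 matrix. *)
Definition saddle_type P w : Prop :=
  exists a b : R[i],
    [/\ multiplier P w a, multiplier P w b, `|a| < 1 & 1 < `|b|].

End BorderCollision.

(* Main.v *)
Require Import Defs.
From mathcomp Require Import all_boot all_order all_algebra.
From mathcomp Require Import all_classical all_reals all_analysis.
From mathcomp Require Import complex ring lra.

Set Implicit Arguments.
Unset Strict Implicit.
Unset Printing Implicit Defensive.

Import Order.TTheory GRing.Theory Num.Theory.
Import numFieldNormedType.Exports.

Local Open Scope classical_set_scope.
Local Open Scope ring_scope.

(** Write [g = d^2 + 1] with [d = deltaR]. The matrix of the word RLR has
    determinant 1 and trace [g/d + d/g], so the RLR-cycle is a saddle with
    multipliers [lam = d/g < 1/2] and [1/lam]; its eigenvectors are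
    [u = (d-1, -1)] (stable) and [v = (d, d-1)] (unstable). In the coordinates
    [(a, b)] along [u] and [v] centred at the RLR fixed point, a point that
    goes once through RLR moves from [(a, b)] to [(lam a, b/lam)]
    ([follow_RLR]). The value of [tauL] is tuned so that the map of the word LR
    sends the unstable direction [v] to a multiple of the stable direction [u]
    and the fixed point itself to a point of its stable line: this is a
    homoclinic connection, and it holds exactly, not just to leading order.

    Closing an orbit of RLR^k LR or RLR^k RR is then a 2 x 2 linear problem in
    [s = lam^k] with explicit solutions: the cycles start at [(-A, -A s/lam)]
    with [A = S_amp s] ([S_closed]) and at [(-A', -d s A')] with
    [A' = S'_amp s] ([S'_closed]). All their points lie strictly on the
    required side of the switching line. Inside the RLR blocks this amounts to
    three linear inequalities on [(a, b)] ([strict_orbit_RLR]); for the first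
    cycle these become, after clearing denominators, inequalities that are
    bilinear in two powers of [lam], so it is enough to look at the corners of
    the unit square ([bilinear_gt0]). The sign at the last point of a cycle can
    be read off the next point, the first one ([xcoord_gt0_of_image]).

    The homoclinic connection removes the term in [lam^-k] from the trace of
    the first word: the trace is [-(1+d)/g lam^k] and the determinant [1/d], so
    the multipliers are complex of modulus [d^(-1/2) < 1]. For the second word
    the trace [(d^2+d+1) lam^-k - d lam^k] exceeds 1 plus the determinant
    [d^2], which forces real multipliers on the two sides of 1
    ([saddle_type_of_trace]). In both cases 1 is not a multiplier, hence
    uniqueness ([cycle_unique]). As the first cycle avoids the switching line,
    the map is affine near each of its points and the linearised evolution
    decides stability ([cycle_asymptotically_stable]). *)

(** * Two-by-two matrices and vectors by coordinates *)

Section Coordinates.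
Context {R : realType}.
Implicit Types (M : 'M[R]_2) (z : 'cV[R]_2).

Definition mx2 (a b c d : R) : 'M[R]_2 :=
  \matrix_(i < 2, j < 2) nth 0 (nth [::] [:: [:: a; b]; [:: c; d]] i) j.

Lemma mx2_eta M : exists a b c d, M = mx2 a b c d.
Proof.
exists (M 0 0), (M 0 1), (M 1 0), (M 1 1); apply/matrixP => i j; rewrite !mxE.
by case: i => [[|[|i]] hi] //; case: j => [[|[|j]] hj] //=;
  congr (M _ _); apply: val_inj.
Qed.

Lemma vec2_eta z : exists x y, z = vec2 x y.
Proof.
exists (z 0 0), (z 1 0); apply/matrixP => i j; rewrite !mxE (ord1 j).
by case: i => [[|[|i]] hi] //; congr (z _ _); apply: val_inj.
Qed.

Lemma mul_mx2 a b c d a' b' c' d' :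
  mx2 a b c d *m mx2 a' b' c' d' =
  mx2 (a * a' + b * c') (a * b' + b * d') (c * a' + d * c') (c * b' + d * d').
Proof.
apply/matrixP => i j; rewrite !mxE !big_ord_recl big_ord0 !mxE /= addr0.
by case: i => [[|[|i]] hi] //; case: j => [[|[|j]] hj].
Qed.

Lemma mul_mx2_vec2 a b c d x y :
  mx2 a b c d *m vec2 x y = vec2 (a * x + b * y) (c * x + d * y).
Proof.
apply/matrixP => i j; rewrite !mxE !big_ord_recl big_ord0 !mxE /= addr0.
by case: i => [[|[|i]] hi].
Qed.

Lemma add_vec2 x y x' y' :
  vec2 x y + vec2 x' y' = vec2 (x + x') (y + y') :> 'cV[R]_2.
Proof. by apply/matrixP => i j; rewrite !mxE; case: i => [[|[|i]] hi]. Qed.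

Lemma scale_vec2 a x y : a *: vec2 x y = vec2 (a * x) (a * y) :> 'cV[R]_2.
Proof. by apply/matrixP => i j; rewrite !mxE; case: i => [[|[|i]] hi]. Qed.

Lemma xcoord_vec2 x y : xcoord (vec2 x y) = x :> R.
Proof. by rewrite /xcoord !mxE. Qed.

Lemma one_mx2 : 1%:M = mx2 1 0 0 1.
Proof.
apply/matrixP => i j; rewrite !mxE.
by case: i => [[|[|i]] hi] //; case: j => [[|[|j]] hj].
Qed.

Lemma trace_mx2 a b c d : \tr (mx2 a b c d) = a + d.
Proof. by rewrite /mxtrace !big_ord_recl big_ord0 !mxE /= addr0. Qed.

Lemma det_mx2 a b c d : \det (mx2 a b c d) = a * d - b * c.
Proof.
rewrite (expand_det_row _ ord0) !big_ord_recl big_ord0 /cofactor !det_mx11.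
by rewrite !mxE /=; ring.
Qed.

(** Cayley-Hamilton along an orbit: [M^n z] obeys a scalar second-order
    recurrence with coefficients the trace and the determinant. *)
Lemma mx2_Cayley_Hamilton M z :
  M *m (M *m z) = \tr M *: (M *m z) + (- \det M) *: z.
Proof.
have [a [b [c [d ->]]]] := mx2_eta M; have [x [y ->]] := vec2_eta z.
rewrite trace_mx2 det_mx2 !mul_mx2_vec2 !scale_vec2 add_vec2.
by congr vec2; ring.
Qed.

(** The hypothesis says that the characteristic polynomial does not vanish
    at 1. *)
Lemma fixed_vector_eq0 M z :
  1 - \tr M + \det M != 0 -> M *m z = z -> z = 0.
Proof.
move=> nz Mz; have := mx2_Cayley_Hamilton M z; rewrite !Mz => /eqP.
rewrite -subr_eq0 -{1}[z]scale1r -scalerDl -scalerBl scaler_eq0.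
rewrite (_ : 1 - _ = 1 - \tr M + \det M) ?(negPf nz) => [/eqP //|].
by ring.
Qed.

Lemma eigenvalue_mx2 M a :
  a ^+ 2 - \tr M * a + \det M = 0 -> eigenvalue M a.
Proof.
move=> ha; have /det0P[v v0 vM] : \det (M - a%:M) == 0.
  rewrite -ha; have [p [q [r [s ->]]]] := mx2_eta M.
  have -> : mx2 p q r s - a%:M = mx2 (p - a) q r (s - a).
    apply/matrixP => i j; rewrite !mxE; case: i => [[|[|i]] hi] //;
    case: j => [[|[|j]] hj] //=; rewrite ?mulr1n ?mulr0n ?subr0 //.
  by rewrite trace_mx2 !det_mx2; apply/eqP; ring.
apply/eigenvalueP; exists v => //; apply/eqP.
by rewrite -subr_eq0 -mul_mx_scalar -mulmxBr vM.
Qed.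

Lemma entry_le_norm m n (z : 'M[R]_(m, n)) i j : `|z i j| <= `|z|.
Proof.
rewrite [leRHS]/Num.norm /= mx_normrE.
exact: (le_bigmax 0 (fun ij => `|z ij.1 ij.2|) (i, j)).
Qed.

Lemma vec2_split x y : vec2 x y = x *: vec2 1 0 + y *: vec2 0 1 :> 'cV[R]_2.
Proof. by rewrite !scale_vec2 add_vec2; congr vec2; ring. Qed.

Lemma norm_mulmx_le M z :
  `|M *m z| <= (`|M *m vec2 1 0| + `|M *m vec2 0 1|) * `|z|.
Proof.
have [x [y zE]] := vec2_eta z; rewrite {1}zE vec2_split mulmxDr -!scalemxAr.
apply: (le_trans (ler_normD _ _)); rewrite !normrZ mulrDl.
have xz : `|x| <= `|z| by have := entry_le_norm z 0 0; rewrite {1}zE mxE.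
have yz : `|y| <= `|z| by have := entry_le_norm z 1 0; rewrite {1}zE mxE.
by apply: lerD; rewrite [leRHS]mulrC; apply: ler_wpM2r.
Qed.

End Coordinates.

(** * Contraction by a matrix with complex multipliers *)

Section Contraction.
Context {R : realType}.

(** When [T^2 < 4 D], the quadratic form [x^2 - T x y + D y^2] is positive
    definite, and the recurrence multiplies its value at [(u n.+1, u n)] by
    exactly [D] at each step. *)
Lemma recurrence2_cvg0 (T D : R) (u : nat -> R) :
  T ^+ 2 < 4 * D -> D < 1 ->
  (forall n, u n.+2 = T * u n.+1 - D * u n) ->
  u n @[n --> \oo] --> 0.
Proof.
move=> TD D1 uE.
have D0 : 0 < D by nra.
pose Q n := u n.+1 ^+ 2 - T * u n.+1 * u n + D * u n ^+ 2.
have QE n : Q n = Q 0%N * D ^+ n.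
  elim: n => [|n IH]; first by rewrite expr0 mulr1.
  by rewrite exprSr mulrA -IH /Q uE; ring.
have uQ n : (D - T ^+ 2 / 4) * u n ^+ 2 <= Q n.
  rewrite -subr_ge0 (_ : _ - _ = (u n.+1 - T / 2 * u n) ^+ 2) ?sqr_ge0 //.
  by rewrite /Q; field.
have k0 : 0 < D - T ^+ 2 / 4 by lra.
have Q0 : (Q 0%N * D ^+ n) @[n --> \oo] --> 0.
  rewrite -(mulr0 (Q 0%N)); apply: cvgM; first exact: cvg_cst.
  by apply: cvg_expr; rewrite ger0_norm // ltW.
apply/cvgr0Pnorm_lt => e e0.
have e2 : 0 < (D - T ^+ 2 / 4) * e ^+ 2 by rewrite mulr_gt0 ?exprn_gt0.
move/cvgr0Pnorm_lt: Q0 => /(_ _ e2); apply: filterS => n /= hn.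
rewrite -(@ltr_pXn2r _ 2) ?nnegrE ?(ltW e0) // -normrX ger0_norm ?sqr_ge0 //.
rewrite -(ltr_pM2l k0); apply: le_lt_trans (uQ n) _; rewrite QE.
by apply: le_lt_trans hn; rewrite ler_norm.
Qed.

Lemma power_cvg0 (M : 'M[R]_2) (z : 'cV[R]_2) :
  \tr M ^+ 2 < 4 * \det M -> \det M < 1 ->
  iter n (mulmx M) z @[n --> \oo] --> (0 : 'cV[R]_2).
Proof.
move=> TD D1; pose u i n := (iter n (mulmx M) z) i 0.
have u0 i : u i n @[n --> \oo] --> 0.
  apply: recurrence2_cvg0 TD D1 _ => n.
  by rewrite /u !iterS mx2_Cayley_Hamilton !mxE mulNr.
rewrite (_ : (fun n => _) =
  fun n => u 0 n *: vec2 1 0 + u 1 n *: vec2 0 1); last first.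
  apply/funext => n; rewrite -vec2_split /u.
  by have [x [y ->]] := vec2_eta (iter n (mulmx M) z); rewrite !mxE.
suff : (fun n => u 0 n *: vec2 1 0 + u 1 n *: vec2 0 1) @ \oo -->
    ((0 : R) *: vec2 1 0 + (0 : R) *: vec2 0 1 : 'cV[R]_2).
  by rewrite !scale0r addr0.
by apply: cvgD; apply: cvgZr_tmp; exact: u0.
Qed.

End Contraction.

(** * Linearised evolution along a periodic word *)

Section Evolution.
Context {R : realType}.
Variables (P : bcnf_params R) (w : word).
Implicit Types (i : 'I_(size w)) (z : 'cV[R]_2).

Definition letter i : symbol := tnth (in_tuple w) i.

Definition phase i t := iter t (@ordS (size w)) i.

(** The derivative of [t] steps of the dynamics that follow the periodic word
    from phase [i]. *)
Fixpoint evol i (t : nat) : 'M[R]_2 :=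
  if t is t'.+1 then Amx P (letter (phase i t')) *m evol i t' else 1%:M.

Lemma phaseD i s t : phase i (s + t) = phase (phase i s) t.
Proof. by rewrite /phase addnC iterD. Qed.

Lemma val_phase i t : phase i t = ((i + t) %% size w)%N :> nat.
Proof.
elim: t => [|t IH]; first by rewrite addn0 modn_small.
by rewrite /phase iterS /= -/(phase i t) IH -addn1 modnDml addn1 addnS.
Qed.

Lemma phase_size i : phase i (size w) = i.
Proof. by apply: val_inj; rewrite /= val_phase modnDr modn_small. Qed.

Lemma evolD i s t : evol i (s + t) = evol (phase i s) t *m evol i s.
Proof.
elim: t => [|t IH]; first by rewrite addn0 mul1mx.
by rewrite addnS /= IH mulmxA phaseD.
Qed.

Lemma evol_period i q z :
  evol i (q * size w) *m z = iter q (mulmx (evol i (size w))) z.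
Proof.
elim: q z => [|q IH] z; first by rewrite mul1mx.
by rewrite mulSn evolD phase_size -mulmxA IH -iterSr.
Qed.

Lemma evol_Mword i : val i = 0%N -> evol i (size w) = Mword P w.
Proof.
move=> i0; rewrite -[in RHS](take_size w).
have : (size w <= size w)%N by [].
elim: {1 3 4}(size w) => [|t IH] tw; first by rewrite take0.
rewrite (take_nth symL) // /Mword foldl_rcons -/(Mword P _) -IH ?(ltnW tw) //=.
congr (Amx P _ *m _).
by rewrite /letter (tnth_nth symL) /= val_phase i0 add0n modn_small.
Qed.

Lemma evol_growth : exists2 K : R, 1 <= K &
  forall i t z, `|evol i t *m z| <= K ^+ t * `|z|.
Proof.
pose k J := `|Amx P J *m vec2 1 0| + `|Amx P J *m vec2 0 1|.
have k0 J : 0 <= k J by rewrite addr_ge0.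
exists (1 + k symL + k symR); first by have := k0 symL; have := k0 symR; lra.
move=> i t z; elim: t => [|t IH] /=; first by rewrite mul1mx mul1r.
rewrite -mulmxA exprS -mulrA; apply: le_trans (norm_mulmx_le _ _) _.
apply: ler_pM => //; rewrite -/(k _); have := k0 symL; have := k0 symR.
by case: (letter _) => ??; lra.
Qed.

Hypothesis w0 : (0 < size w)%N.
Hypothesis trM : \tr (Mword P w) ^+ 2 < 4 * \det (Mword P w).
Hypothesis detM : \det (Mword P w) < 1.

(** Over whole periods the evolution is a power of [Mword P w]; the fewer than
    [size w] remaining steps enlarge by a bounded factor. *)
Lemma evol_cvg0_start z :
  evol (Ordinal w0) t *m z @[t --> \oo] --> (0 : 'cV[R]_2).
Proof.
have [K K1 HK] := evol_growth.
have Kn0 : 0 < K ^+ size w by rewrite exprn_gt0 ?(lt_le_trans ltr01).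
have M0 := @power_cvg0 _ (Mword P w) z trM detM.
apply/cvgr0Pnorm_lt => e e0.
move/cvgr0Pnorm_lt: M0 => /(_ (e / K ^+ size w)) [|N _ HN].
  by rewrite divr_gt0.
exists (N * size w)%N => // t /= Nt.
rewrite {1}(divn_eq t (size w)) evolD -mulmxA evol_period evol_Mword //.
apply: le_lt_trans (HK _ _ _) _.
rewrite -ltr_pdivlMl ?exprn_gt0 ?(lt_le_trans ltr01) //.
apply: lt_le_trans (HN _ _) _; first by rewrite /= leq_divRL.
rewrite mulrC; apply: ler_wpM2r; first exact: ltW.
rewrite lef_pV2 ?posrE ?exprn_gt0 ?(lt_le_trans ltr01) //.
by rewrite ler_weXn2l // ltnW // ltn_pmod.
Qed.

(** From any phase the orbit reaches the start of the word after
    [size w - i] steps, so convergence from there suffices. *)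
Lemma evol_cvg0 i z : evol i t *m z @[t --> \oo] --> (0 : 'cV[R]_2).
Proof.
rewrite -(cvg_shiftn (size w - i)%N).
rewrite (_ : (fun t => _) = fun t =>
  evol (Ordinal w0) t *m (evol i (size w - i)%N *m z)).
  exact: evol_cvg0_start.
apply/funext => t; rewrite addnC evolD mulmxA; congr (evol _ _ *m _ *m _).
by apply: val_inj; rewrite /= val_phase subnKC ?modnn // ltnW.
Qed.

(** Uniform boundedness: by linearity it is enough to bound the convergent
    orbits of the two basis vectors, from each of the finitely many phases. *)
Lemma evol_bounded : exists2 c : R, 1 <= c &
  forall i t z, `|evol i t *m z| <= c * `|z|.
Proof.
have bnd i z : exists c : R, forall t, `|evol i t *m z| <= c.
  have /cvg_seq_bounded[c [_ hc]] : cvgn (fun t => evol i t *m z).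
    by apply/cvg_ex; exists 0; exact: evol_cvg0.
  by exists (c + 1) => t; apply: hc; rewrite ?ltrDl.
have [c1 hc1] := choice (fun i => bnd i (vec2 1 0)).
have [c2 hc2] := choice (fun i => bnd i (vec2 0 1)).
pose c i := c1 i + c2 i.
exists (\big[Order.max/1]_i c i); first exact: bigmax_ge_id.
move=> i t z; apply: le_trans (norm_mulmx_le _ _) _; apply: ler_wpM2r => //.
apply: le_trans (lerD (hc1 i t) (hc2 i t)) _; exact: (le_bigmax _ c i).
Qed.

End Evolution.

(** * Stability of a cycle that avoids the switching line *)

Section Cycles.
Context {R : realType}.
Variables (P : bcnf_params R) (w : word).
Implicit Types (z : 'cV[R]_2) (p : {ffun 'I_(size w) -> 'cV[R]_2}).

Definition strict_side (J : symbol) z : bool :=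
  if J is symL then xcoord z < 0 else 0 < xcoord z.

Lemma fpieceB J z z' : fpiece P J z - fpiece P J z' = Amx P J *m (z - z').
Proof. by rewrite /fpiece mulmxBr opprD addrACA subrr addr0. Qed.

Lemma cycle_phase p i t : is_cycle P p ->
  p (phase i t.+1) = fpiece P (letter (phase i t)) (p (phase i t)).
Proof. by move=> hp; rewrite -hp. Qed.

Lemma cycle_diff p p' i t : is_cycle P p -> is_cycle P p' ->
  p (phase i t) - p' (phase i t) = evol P i t *m (p i - p' i).
Proof.
move=> hp hp'; elim: t => [|t IH]; first by rewrite mul1mx.
by rewrite !cycle_phase // fpieceB IH mulmxA.
Qed.

(** The difference of two cycles at phase 0 is fixed by [Mword P w]. *)
Lemma cycle_unique p : (0 < size w)%N ->
  1 - \tr (Mword P w) + \det (Mword P w) != 0 ->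
  is_cycle P p -> unique (is_cycle P (w := w)) p.
Proof.
move=> w0 nz hp; split=> // p' hp'; pose i0 := Ordinal w0.
have d0 : p i0 - p' i0 = 0.
  apply: fixed_vector_eq0 nz _.
  by rewrite -(@evol_Mword _ P w i0) // -cycle_diff // phase_size.
apply/ffunP => i; have -> : i = phase i0 i.
  by apply: val_inj; rewrite /= val_phase add0n modn_small.
by apply/eqP; rewrite -subr_eq0 cycle_diff // d0 mulmx0.
Qed.

Hypothesis w0 : (0 < size w)%N.
Variable p : {ffun 'I_(size w) -> 'cV[R]_2}.
Hypothesis hp : is_cycle P p.
Hypothesis side_p : forall i, strict_side (letter i) (p i).

(** The radius is the least distance of a point of the cycle to the switching
    line in the sup norm, capped at 1. *)
Lemma bcnf_near_cycle : exists2 r : R, 0 < r &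
  forall i z, `|z - p i| < r -> bcnf P z = fpiece P (letter i) z.
Proof.
pose r := \big[Order.min/1]_i `|xcoord (p i)|.
exists r.
  apply: lt_bigmin => // i _; rewrite normr_gt0.
  have := side_p i; rewrite /strict_side.
  by case: letter => [/ltr0_neq0|/lt0r_neq0].
move=> i z zr.
have : `|xcoord z - xcoord (p i)| < `|xcoord (p i)|.
  apply: lt_le_trans (_ : r <= _); last exact: bigmin_le.
  by apply: le_lt_trans zr; have := entry_le_norm (z - p i) 0 0; rewrite !mxE.
have := side_p i; rewrite /strict_side /bcnf; case: letter => xp.
  rewrite (ltr0_norm xp) ltr_norml => /andP[_ h].
  by rewrite ifT //; lra.
rewrite (gtr0_norm xp) ltr_norml => /andP[h _].
by rewrite ifF //; apply/negbTE; rewrite -ltNge; lra.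
Qed.

Lemma iter_bcnf_cycle i t : iter t (bcnf P) (p i) = p (phase i t).
Proof.
have [r r0 hr] := bcnf_near_cycle.
elim: t => [//|t IH]; rewrite iterS IH cycle_phase //.
by apply: hr; rewrite subrr normr0.
Qed.

(** An orbit that starts within [r / c] of the cycle, where [c] bounds the
    linearised evolution and [r] is a radius of affinity of the map, never
    leaves the zone where the map is affine; so its distance to the cycle is
    given exactly by [evol]. *)
Lemma cycle_asymptotically_stable :
  \tr (Mword P w) ^+ 2 < 4 * \det (Mword P w) -> \det (Mword P w) < 1 ->
  asymptotically_stable P p.
Proof.
move=> trM detM i.
have [r r0 hr] := bcnf_near_cycle.
have [c c1 hc] := evol_bounded w0 trM detM.
have c0 : 0 < c by exact: lt_le_trans c1.
have lin z t : `|z - p i| < r / c ->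
    iter t (bcnf P) z - iter t (bcnf P) (p i) = evol P i t *m (z - p i).
  move=> zr; rewrite iter_bcnf_cycle; elim: t => [|t IH].
    by rewrite mul1mx.
  rewrite iterS (hr (phase i t)).
    by rewrite cycle_phase // fpieceB IH mulmxA.
  rewrite IH; apply: le_lt_trans (hc _ _ _) _.
  by rewrite -ltr_pdivlMl // mulrC.
split.
  move=> e e0; exists (Order.min (r / c) (e / c)).
    by rewrite lt_min !divr_gt0.
  move=> z; rewrite lt_min => /andP[zr ze] t; rewrite lin //.
  by apply: le_lt_trans (hc _ _ _) _; rewrite -ltr_pdivlMl // mulrC.
exists (r / c); first by rewrite divr_gt0.
move=> z zr; under eq_fun do rewrite lin //.
exact: evol_cvg0.
Qed.

End Cycles.

(** * Words, closed orbits and cycles *)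

Lemma wpow_S k (w : word) : wpow k.+1 w = w ++ wpow k w.
Proof. by []. Qed.

Section Orbits.
Context {R : realType}.
Variables (P : bcnf_params R).
Implicit Types (w : word) (z : 'cV[R]_2).

Definition follow w z : 'cV[R]_2 := foldl (fun z J => fpiece P J z) z w.

Fixpoint strict_orbit w z : bool :=
  if w is J :: w' then strict_side J z && strict_orbit w' (fpiece P J z)
  else true.

Lemma strict_orbit_cat w w' z :
  strict_orbit (w ++ w') z = strict_orbit w z && strict_orbit w' (follow w z).
Proof. by elim: w z => //= J w IH z; rewrite IH andbA. Qed.

Lemma foldl_Amx w (M : 'M[R]_2) :
  foldl (fun (M : 'M[R]_2) J => Amx P J *m M) M w = Mword P w *m M.
Proof.
rewrite /Mword; elim/last_ind: w => [|w J IH]; first by rewrite mul1mx.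
by rewrite !foldl_rcons IH mulmxA.
Qed.

Lemma Mword_cat w w' :
  Mword P (w ++ w') = Mword P w' *m Mword P w.
Proof. by rewrite /Mword foldl_cat foldl_Amx. Qed.

Lemma follow_cat w w' z : follow (w ++ w') z = follow w' (follow w z).
Proof. exact: foldl_cat. Qed.

Lemma strict_orbit_nth w z j : strict_orbit w z -> (j < size w)%N ->
  strict_side (nth symL w j) (follow (take j w) z).
Proof.
elim: w z j => // J w IH z [|j] /= /andP[hz hw] jw //.
exact: IH.
Qed.

Lemma cycle_of_closed_orbit w z : follow w z = z -> strict_orbit w z ->
  exists p : {ffun 'I_(size w) -> 'cV[R]_2},
    is_cycle P p /\ forall i, strict_side (letter i) (p i).
Proof.
move=> wz hz; exists [ffun i : 'I_(size w) => follow (take i w) z]; split=> i.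
  rewrite !ffunE (tnth_nth symL) /=.
  have -> : fpiece P (nth symL w i) (follow (take i w) z) =
      follow (take i.+1 w) z.
    by rewrite (take_nth symL) // /follow foldl_rcons.
  have : (i < size w)%N by []; rewrite leq_eqVlt => /predU1P[iw|iw].
    by rewrite iw modnn take0 take_size wz.
  by rewrite modn_small.
by rewrite ffunE /letter (tnth_nth symL); apply: strict_orbit_nth.
Qed.

Lemma admissible_strict w (p : {ffun 'I_(size w) -> 'cV[R]_2}) :
  (forall i, strict_side (letter i) (p i)) -> admissible p.
Proof.
move=> hp i; have := hp i; rewrite /letter /strict_side.
by case: (tnth _ _) => /= xp; exact: ltW.
Qed.

(** The characteristic polynomial is negative at 1, so it has two real roots
    around 1; the smaller one is positive, and it is the product [D] divided by
    the larger one, which exceeds [D] because [s > D - 1]. *)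
Lemma saddle_type_of_trace w :
  0 < \det (Mword P w) -> 1 + \det (Mword P w) < \tr (Mword P w) ->
  saddle_type P w.
Proof.
set M := Mword P w; set T := \tr M; set D := \det M => D0 TD.
pose s := Num.sqrt (T ^+ 2 - 4 * D).
have disc : (1 - D) ^+ 2 < T ^+ 2 - 4 * D.
  rewrite -subr_gt0 (_ : _ - _ = (T - (1 + D)) * (T + (1 + D))); last by ring.
  by rewrite mulr_gt0 ?subr_gt0 // !addr_gt0 // (lt_trans _ TD) ?addr_gt0.
have s2 : s ^+ 2 = T ^+ 2 - 4 * D.
  by rewrite sqr_sqrtr // (le_trans _ (ltW disc)) ?sqr_ge0.
have s0 : 0 <= s by exact: sqrtr_ge0.
have sD : `|1 - D| < s.
  by rewrite -(@ltr_pXn2r _ 2) ?nnegrE // s2 real_normK ?num_real.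
have /andP[sD1 sD2] : (- s < 1 - D) && (1 - D < s) by rewrite -ltr_norml.
have nrm (a : R) : `|real_complex R a| = real_complex R `|a|.
  by rewrite normc_def /= expr0n addr0 sqrtr_sqr.
exists (real_complex R ((T - s) / 2)), (real_complex R ((T + s) / 2)); split.
- rewrite /multiplier eigenvalue_map; apply: eigenvalue_mx2.
  by rewrite -/M -/T -/D; field: s2.
- rewrite /multiplier eigenvalue_map; apply: eigenvalue_mx2.
  by rewrite -/M -/T -/D; field: s2.
- rewrite nrm -(rmorph1 (real_complex R)) ltcR ltr_norml.
  by apply/andP; split; nra.
- by rewrite nrm -(rmorph1 (real_complex R)) ltcR ger0_norm; lra.
Qed.

End Orbits.

(** * The word RLR at the given parameters *)

(** A function that is affine in each variable is, on the unit square, a convex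
    combination of its values at the four corners. *)
Lemma bilinear_gt0 (R : realType) (c0 c1 c2 c3 p q : R) :
  0 < c0 -> 0 < c0 + c1 -> 0 < c0 + c2 -> 0 < c0 + c1 + c2 + c3 ->
  0 <= p <= 1 -> 0 <= q <= 1 -> 0 < c0 + c1 * p + c2 * q + c3 * (p * q).
Proof.
move=> h00 h10 h01 h11 /andP[p0 p1] /andP[q0 q1].
have hp1 : 0 < (1 - q) * (c0 + c1) + q * (c0 + c1 + c2 + c3).
  by case: (ltrP q 1) => qq; nra.
have hp0 : 0 < (1 - q) * c0 + q * (c0 + c2).
  by case: (ltrP q 1) => qq; nra.
by case: (ltrP p 1) => pp; nra.
Qed.

Section TunedMap.
Context {R : realType}.
Variable d : R.
Hypothesis d1 : 1 < d.

Definition params : bcnf_params R := {|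
  tauL := -1 + 1 / d - 1 / (d ^+ 2 * (d ^+ 2 + 1));
  deltaL := 1 / d ^+ 2;
  tauR := -1 - d;
  deltaR := d;
  mu := 1 |}.

Definition RLR : word := [:: symR; symL; symR].

Definition lam : R := d / (d ^+ 2 + 1).

Definition fpt_den : R := d ^+ 2 - d + 1.

(** Coordinates along the eigenvectors [(d-1, -1)] and [(d, d-1)] of the RLR
    map, centred at its fixed point [(d^2, -1) / fpt_den] and scaled by
    [fpt_den], which is also the determinant of the two eigenvectors. *)
Definition saddle_pt (a b : R) : 'cV[R]_2 :=
  vec2 ((d ^+ 2 + (d - 1) * a + d * b) / fpt_den)
       ((- 1 - a + (d - 1) * b) / fpt_den).

(** The matrix with eigenvalue [s] on [(d-1, -1)] and [s^-1] on [(d, d-1)]. *)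
Definition saddle_mx (s : R) : 'M[R]_2 :=
  mx2 (((d - 1) ^+ 2 * s + d / s) / fpt_den)
      (d * (d - 1) * (s^-1 - s) / fpt_den)
      ((d - 1) * (s^-1 - s) / fpt_den)
      ((d * s + (d - 1) ^+ 2 / s) / fpt_den).

Lemma d_gt0 : 0 < d. Proof. exact: lt_trans d1. Qed.
Lemma d_neq0 : d != 0. Proof. exact: lt0r_neq0 d_gt0. Qed.
Lemma sqrd1_gt0 : 0 < d ^+ 2 + 1. Proof. by have := d_gt0; nra. Qed.
Lemma sqrd1_neq0 : d ^+ 2 + 1 != 0. Proof. exact: lt0r_neq0 sqrd1_gt0. Qed.
Lemma fpt_den_gt0 : 0 < fpt_den. Proof. by rewrite /fpt_den; nra. Qed.
Lemma fpt_den_neq0 : d ^+ 2 - d + 1 != 0.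
Proof. exact: lt0r_neq0 fpt_den_gt0. Qed.
Lemma lam_gt0 : 0 < lam. Proof. by rewrite divr_gt0 ?d_gt0 ?sqrd1_gt0. Qed.
Lemma lam_lt_half : lam < 1 / 2.
Proof.
rewrite /lam ltr_pdivrMr ?sqrd1_gt0 //.
have : 0 < (d - 1) ^+ 2 by rewrite exprn_gt0 // subr_gt0.
by lra.
Qed.

Let nz := (d_neq0, sqrd1_neq0, fpt_den_neq0).

Lemma fpiece_vec2 J x y : fpiece params J (vec2 x y) =
  vec2 (tau params J * x + y + 1) (- delta params J * x).
Proof.
rewrite /fpiece -[Amx _ _]/(mx2 (tau params J) 1 (- delta params J) 0).
by rewrite mul_mx2_vec2 scale_vec2 add_vec2 /=; congr vec2; ring.
Qed.

Lemma fpieceR_saddle a b : fpiece params symR (saddle_pt a b) =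
  vec2 (- (d * (d ^+ 2 + 1) + d ^+ 2 * a + (d ^+ 2 + 1) * b) / fpt_den)
       (- (d ^+ 3 + d * (d - 1) * a + d ^+ 2 * b) / fpt_den).
Proof.
by rewrite fpiece_vec2 /= /fpt_den; congr vec2; field; rewrite ?nz.
Qed.

Lemma fpieceLR_saddle a b :
  fpiece params symL (fpiece params symR (saddle_pt a b)) =
  vec2 ((d * (d ^+ 2 + 1) + d ^+ 2 * a - (d - 1) * (d ^+ 2 + 1) ^+ 2 * b)
          / (d ^+ 2 * (d ^+ 2 + 1) * fpt_den))
       ((d * (d ^+ 2 + 1) + d ^+ 2 * a + (d ^+ 2 + 1) * b)
          / (d ^+ 2 * fpt_den)).
Proof.
rewrite fpieceR_saddle fpiece_vec2 /= /fpt_den.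
by congr vec2; field; rewrite ?nz.
Qed.

Lemma follow_RLR a b :
  follow params RLR (saddle_pt a b) = saddle_pt (lam * a) (b / lam).
Proof.
rewrite /follow /= fpieceLR_saddle fpiece_vec2 /saddle_pt /lam /= /fpt_den.
by congr vec2; field; rewrite ?nz.
Qed.

(** The three hypotheses are the signs at the three points of the block, with
    positive denominators cleared. *)
Lemma strict_orbit_RLR a b :
  0 < d ^+ 2 + (d - 1) * a + d * b ->
  0 < d * (d ^+ 2 + 1) + d ^+ 2 * a + (d ^+ 2 + 1) * b ->
  0 < d * (d ^+ 2 + 1) + d ^+ 2 * a - (d - 1) * (d ^+ 2 + 1) ^+ 2 * b ->
  strict_orbit params RLR (saddle_pt a b).
Proof.
move=> h0 h1 h2; have m0 := fpt_den_gt0; have g0 := sqrd1_gt0; have d0 := d_gt0.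
rewrite /= fpieceLR_saddle fpieceR_saddle !xcoord_vec2 andbT.
by rewrite mulNr oppr_lt0 !divr_gt0 // !mulr_gt0.
Qed.

Lemma follow_RLR_pow k a b : follow params (wpow k RLR) (saddle_pt a b) =
  saddle_pt (lam ^+ k * a) (b / lam ^+ k).
Proof.
elim: k a b => [|k IH] a b; first by rewrite expr0 mul1r divr1.
rewrite wpow_S follow_cat follow_RLR IH exprSr; congr (saddle_pt _ _).
  by rewrite mulrA.
by rewrite (invfM (lam ^+ k)) -[LHS]mulrA [X in _ * X]mulrC.
Qed.

Lemma strict_orbit_RLR_pow k a b :
  (forall j, (j < k)%N ->
    strict_orbit params RLR (saddle_pt (lam ^+ j * a) (b / lam ^+ j))) ->
  strict_orbit params (wpow k RLR) (saddle_pt a b).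
Proof.
elim: k a b => // k IH a b H.
rewrite wpow_S strict_orbit_cat follow_RLR; apply/andP; split.
  by have := H 0%N isT; rewrite expr0 mul1r divr1.
apply: IH => j jk; have := H j.+1 jk.
by rewrite exprSr (invfM (lam ^+ j)) -[_ * lam * a]mulrA
  [lam ^- j / lam]mulrC [b * (_ / _)]mulrA.
Qed.

Lemma saddle_mxM s s' : s != 0 -> s' != 0 ->
  saddle_mx s *m saddle_mx s' = saddle_mx (s * s').
Proof.
move=> s0 s0'; rewrite mul_mx2 /saddle_mx /fpt_den.
by congr mx2; field; rewrite ?nz ?s0 ?s0'.
Qed.

Lemma saddle_mx1 : saddle_mx 1 = 1%:M.
Proof.
rewrite one_mx2 /saddle_mx /fpt_den invr1 subrr.
by congr mx2; field; rewrite ?nz.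
Qed.

Lemma AmxE J : Amx params J = mx2 (tau params J) 1 (- delta params J) 0.
Proof. by []. Qed.

Lemma Mword_RLR : Mword params RLR = saddle_mx lam.
Proof.
rewrite /Mword /= mulmx1 !AmxE !mul_mx2 /saddle_mx /lam /= /fpt_den.
by congr mx2; field; rewrite ?nz.
Qed.

Lemma Mword_RLR_pow k : Mword params (wpow k RLR) = saddle_mx (lam ^+ k).
Proof.
elim: k => [|k IH]; first by rewrite saddle_mx1.
have l0 := lt0r_neq0 lam_gt0.
by rewrite wpow_S Mword_cat IH Mword_RLR saddle_mxM ?expf_neq0 // exprSr.
Qed.

(** * The stable cycle *)

(** Closing the orbit means [a = h + B11 a s + B12 b / s] and [b = B21 a s],
    where the [Bij] represent the LR map in the saddle coordinates; the second
    equation has no constant and no [B22] because of the homoclinic connection.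
    This gives [b = a s / lam] and [a = - S_amp s]. *)
Definition S_amp (s : R) : R :=
  d * (d ^+ 2 + d + 1) / ((1 + d) * (d ^+ 2 + 1 + d * s)).

Lemma S_amp_den_gt0 s : 0 <= s -> 0 < (1 + d) * (d ^+ 2 + 1 + d * s).
Proof.
move=> s0; have d0 := d_gt0; have g0 := sqrd1_gt0.
apply: mulr_gt0; first lra.
by apply: ltr_wpDr => //; apply: mulr_ge0 => //; exact: ltW.
Qed.

Lemma S_amp_gt0 s : 0 <= s -> 0 < S_amp s.
Proof.
move=> s0; have d0 := d_gt0; rewrite divr_gt0 ?S_amp_den_gt0 //.
by rewrite mulr_gt0 //; nra.
Qed.

Lemma S_amp_lt1 s : 0 <= s -> S_amp s < 1.
Proof.
move=> s0; have d0 := d_gt0.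
rewrite ltr_pdivrMr ?S_amp_den_gt0 // mul1r.
have : 0 <= (1 + d) * (d * s) by rewrite !mulr_ge0 //; lra.
by nra.
Qed.

(** The points of the stable cycle at the start of the RLR blocks have
    [p = lam^j] and [q = lam^(k-1-j)]. *)
Lemma S_block_strict p q : 0 < p <= 1 -> 0 < q <= 1 ->
  let a := - S_amp (lam * (p * q)) in
  strict_orbit params RLR (saddle_pt (p * a) (q * a)).
Proof.
move=> /andP[p0 p1] /andP[q0 q1].
have d0 := d_gt0; have g0 := sqrd1_gt0.
have l0 := lam_gt0.
have s0 : 0 <= lam * (p * q) by exact/ltW/mulr_gt0/mulr_gt0.
have A0 := S_amp_gt0 s0; have A1 := S_amp_lt1 s0.
set A := S_amp _ in A0 A1 *; cbv zeta.
(* The denominator of [A], times [d^2 + 1] to clear the one of [lam]. *)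
pose K := (1 + d) * ((d ^+ 2 + 1) ^+ 2 + d ^+ 2 * (p * q)).
have K0 : 0 < K.
  apply: mulr_gt0; first lra.
  by rewrite addr_gt0 ?exprn_gt0 // !mulr_gt0 // exprn_gt0.
have KA : K * A = d * (d ^+ 2 + 1) * (d ^+ 2 + d + 1).
  have D0 := lt0r_neq0 (S_amp_den_gt0 s0).
  rewrite /A /S_amp.
  have -> : K = (d ^+ 2 + 1) * ((1 + d) * (d ^+ 2 + 1 + d * (lam * (p * q)))).
    by rewrite /K /lam; field; rewrite ?nz.
  by move: D0; move: (_ * (_ + _ + _)) => X X0; field.
have p01 : 0 <= p <= 1 by rewrite ltW.
have q01 : 0 <= q <= 1 by rewrite ltW.
apply: strict_orbit_RLR.
- rewrite -(pmulr_rgt0 _ K0).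
  have -> : K * (d ^+ 2 + (d - 1) * (p * - A) + d * (q * - A)) =
     d * (d * (1 + d) * (d ^+ 2 + 1) ^+ 2
     + - ((d ^+ 2 + 1) * (d ^+ 2 + d + 1) * (d - 1)) * p
     + - ((d ^+ 2 + 1) * (d ^+ 2 + d + 1) * d) * q
     + d * (1 + d) * d ^+ 2 * (p * q)).
    transitivity (K * d ^+ 2 - (K * A) * ((d - 1) * p + d * q)); first by ring.
    by rewrite KA /K; ring.
  apply: mulr_gt0 => //; apply: bilinear_gt0 => //.
  + by rewrite !mulr_gt0 ?exprn_gt0 //; lra.
  + rewrite [X in 0 < X](_ : _ =
      (d ^+ 2 + 1) * (d ^+ 4 + d ^+ 2 + d + 1)); last by ring.
    by rewrite mulr_gt0 // !addr_gt0 // exprn_gt0.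
  + rewrite [X in 0 < X](_ : _ = (d ^+ 2 + 1) * (d * d ^+ 3)); last by ring.
    by rewrite !mulr_gt0 // exprn_gt0.
  + rewrite [X in 0 < X](_ : _ =
      d ^+ 5 * (d - 1) + 2 * d ^+ 4 + d ^+ 2 + 1); last by ring.
    by rewrite !addr_gt0 // ?mulr_gt0 ?exprn_gt0 // subr_gt0.
- rewrite -(pmulr_rgt0 _ K0).
  have -> : K * (d * (d ^+ 2 + 1) + d ^+ 2 * (p * - A)
                 + (d ^+ 2 + 1) * (q * - A)) =
     (d * (d ^+ 2 + 1)) * ((1 + d) * (d ^+ 2 + 1) ^+ 2
     + - ((d ^+ 2 + d + 1) * d ^+ 2) * p
     + - ((d ^+ 2 + d + 1) * (d ^+ 2 + 1)) * q
     + (1 + d) * d ^+ 2 * (p * q)).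
    transitivity (K * (d * (d ^+ 2 + 1))
      - (K * A) * (d ^+ 2 * p + (d ^+ 2 + 1) * q)); first by ring.
    by rewrite KA /K; ring.
  apply: mulr_gt0; first by rewrite mulr_gt0.
  apply: bilinear_gt0 => //.
  + by rewrite mulr_gt0 ?exprn_gt0 //; lra.
  + rewrite [X in 0 < X](_ : _ =
      d ^+ 5 + d ^+ 3 + d ^+ 2 + d + 1); last by ring.
    by rewrite !addr_gt0 // exprn_gt0.
  + rewrite [X in 0 < X](_ : _ = (d ^+ 2 + 1) * d ^+ 3); last by ring.
    by rewrite mulr_gt0 // exprn_gt0.
  + rewrite [X in 0 < X](_ : _ = d ^+ 4 * (d - 1) + d ^+ 3); last by ring.
    by rewrite addr_gt0 // ?mulr_gt0 ?exprn_gt0 // subr_gt0.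
- have e0 : 0 <= (d - 1) * (d ^+ 2 + 1) ^+ 2.
    by rewrite mulr_ge0 ?subr_ge0 ?exprn_ge0 // ltW.
  have qA : 0 <= q * A by apply/ltW/mulr_gt0.
  have pA : p * A < 1 by nra.
  have : 0 <= (d - 1) * (d ^+ 2 + 1) ^+ 2 * (q * A) by exact: mulr_ge0.
  have : 0 < d ^+ 2 * (1 - p * A) by rewrite mulr_gt0 ?exprn_gt0 ?subr_gt0.
  have : 0 < d * (d - 1) ^+ 2 by rewrite mulr_gt0 ?exprn_gt0 ?subr_gt0.
  by nra.
Qed.

Lemma S_closed s : 0 < s ->
  fpiece params symR (fpiece params symL
    (saddle_pt (s * - S_amp s) (- S_amp s / lam))) =
  saddle_pt (- S_amp s) (- S_amp s * (s / lam)).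
Proof.
move=> s0; have d0 := d_gt0.
have D1 : d ^+ 2 + 1 + d * s != 0.
  by rewrite lt0r_neq0 // addr_gt0 ?mulr_gt0 // sqrd1_gt0.
have D2 : 1 + d != 0 by rewrite lt0r_neq0 // addr_gt0.
rewrite !fpiece_vec2 /saddle_pt /S_amp /lam /= /fpt_den.
by congr vec2; field; rewrite ?nz ?D1 ?D2.
Qed.

(** The second coordinate of the image under the right piece is [- d x], so
    the sign of [x] is known once the image is. *)
Lemma xcoord_gt0_of_image z a b : fpiece params symR z = saddle_pt a b ->
  0 < 1 + a - (d - 1) * b -> 0 < xcoord z.
Proof.
have [x [y ->]] := vec2_eta z; rewrite fpiece_vec2 xcoord_vec2 /= => zE ab.
have := congr1 (fun v : 'cV[R]_2 => v 1 0) zE; rewrite !mxE /= => xE.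
have m0 := fpt_den_gt0; have d0 := d_gt0.
have : 0 < d * x.
  rewrite (_ : d * x = (1 + a - (d - 1) * b) / fpt_den) ?divr_gt0 //.
  by rewrite -[LHS]opprK -mulNr xE -mulNr; congr (_ / _); ring.
by rewrite pmulr_rgt0.
Qed.

Lemma S_tail_strict s : 0 < s < 1 ->
  strict_orbit params [:: symL; symR]
    (saddle_pt (s * - S_amp s) (- S_amp s / lam)).
Proof.
move=> /andP[s0 s1]; have C := S_closed s0.
have d0 := d_gt0; have g0 := sqrd1_gt0; have m0 := fpt_den_gt0.
have A0 := S_amp_gt0 (ltW s0); have A1 := S_amp_lt1 (ltW s0).
have D0 := S_amp_den_gt0 (ltW s0).
rewrite /= andbT; apply/andP; split; last first.
  apply: xcoord_gt0_of_image C _.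
  have : 0 <= (d - 1) * (S_amp s * (s / lam)).
    apply: mulr_ge0; first by rewrite subr_ge0 ltW.
    by apply/ltW/mulr_gt0/divr_gt0 => //; exact: lam_gt0.
  by lra.
rewrite xcoord_vec2 pmulr_llt0 ?invr_gt0 //.
rewrite (_ : _ + _ = d ^+ 2 - S_amp s * ((d - 1) * s + (d ^+ 2 + 1)));
    last first.
  by rewrite /lam; field; rewrite ?nz.
rewrite subr_lt0 /S_amp mulrAC ltr_pdivlMr // -subr_gt0.
rewrite (_ : _ - _ = d * ((d ^+ 2 + 1) * (1 - s))); last by ring.
by rewrite !mulr_gt0 // subr_gt0.
Qed.

(** * The saddle cycle *)

(** Here both closing equations carry constants; their solution is
    [a = - S'_amp s] and [b = - d s S'_amp s]. *)
Definition S'_amp (s : R) : R := (d ^+ 2 + d + 1) / (d ^+ 2 + d + 1 + d * s).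

Lemma S'_amp_den_gt0 s : 0 <= s -> 0 < d ^+ 2 + d + 1 + d * s.
Proof.
move=> s0; have d0 := d_gt0.
by rewrite ltr_wpDr ?mulr_ge0 ?(ltW d0) // !addr_gt0 // exprn_gt0.
Qed.

Lemma S'_amp_gt0 s : 0 <= s -> 0 < S'_amp s.
Proof.
move=> s0; have d0 := d_gt0; rewrite divr_gt0 ?S'_amp_den_gt0 //.
by rewrite !addr_gt0 // exprn_gt0.
Qed.

Lemma S'_amp_lt1 s : 0 < s -> S'_amp s < 1.
Proof.
move=> s0; rewrite ltr_pdivrMr ?S'_amp_den_gt0 ?(ltW s0) // mul1r ltrDl.
by rewrite mulr_gt0 // d_gt0.
Qed.

Lemma S'_closed s : 0 < s ->
  fpiece params symR (fpiece params symR
    (saddle_pt (s * - S'_amp s) (d * - S'_amp s))) =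
  saddle_pt (- S'_amp s) (d * s * - S'_amp s).
Proof.
move=> s0; have d0 := d_gt0.
have D1 := lt0r_neq0 (S'_amp_den_gt0 (ltW s0)).
rewrite !fpiece_vec2 /saddle_pt /S'_amp /= /fpt_den.
by congr vec2; field; rewrite ?nz ?D1.
Qed.

(** At the start of the RLR blocks, [p = lam^j] and [q = lam^(k-j)] with
    [j < k]; since [q <= lam < 1/2] there is room enough for crude bounds. *)
Lemma S'_block_strict (A p q : R) : 0 < A < 1 -> 0 < p <= 1 -> 0 < q <= lam ->
  strict_orbit params RLR (saddle_pt (p * - A) (d * q * - A)).
Proof.
move=> /andP[A0 A1] /andP[p0 p1] /andP[q0 ql].
have d0 := d_gt0; have g0 := sqrd1_gt0.
have gl : (d ^+ 2 + 1) * lam = d by rewrite /lam; field; rewrite ?nz.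
have gq : (d ^+ 2 + 1) * q <= d by rewrite -[leRHS]gl ler_pM2l.
have pA0 : 0 < p * A by exact: mulr_gt0.
have pA : p * A < 1 by nra.
have qA0 : 0 < q * A by exact: mulr_gt0.
have gqA : (d ^+ 2 + 1) * (q * A) < d.
  rewrite mulrA; apply: lt_le_trans gq.
  by rewrite gtr_pMr // mulr_gt0.
have q2 : q * A < 1 / 2 by have := lam_lt_half; nra.
apply: strict_orbit_RLR.
- have : 0 < d ^+ 2 * (1 / 2 - q * A) by rewrite mulr_gt0 ?exprn_gt0 ?subr_gt0.
  have : 0 < (d - 1) * (1 - p * A) by rewrite mulr_gt0 ?subr_gt0.
  by nra.
- have : 0 < d ^+ 2 * (1 - p * A) by rewrite mulr_gt0 ?exprn_gt0 ?subr_gt0.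
  have : 0 < d * (d - (d ^+ 2 + 1) * (q * A)) by rewrite mulr_gt0 ?subr_gt0.
  have : 0 < d * (d - 1) ^+ 2 by rewrite mulr_gt0 ?exprn_gt0 ?subr_gt0.
  by nra.
- have : 0 <= (d - 1) * (d ^+ 2 + 1) ^+ 2 * (d * (q * A)).
    apply: mulr_ge0; last exact/ltW/mulr_gt0.
    by rewrite mulr_ge0 ?subr_ge0 ?exprn_ge0 // ltW.
  have : 0 < d ^+ 2 * (1 - p * A) by rewrite mulr_gt0 ?exprn_gt0 ?subr_gt0.
  have : 0 < d * (d - 1) ^+ 2 by rewrite mulr_gt0 ?exprn_gt0 ?subr_gt0.
  by nra.
Qed.

Lemma S'_tail_strict s : 0 < s ->
  strict_orbit params [:: symR; symR]
    (saddle_pt (s * - S'_amp s) (d * - S'_amp s)).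
Proof.
move=> s0; have C := S'_closed s0.
have d0 := d_gt0; have m0 := fpt_den_gt0.
have A0 := S'_amp_gt0 (ltW s0); have A1 := S'_amp_lt1 s0.
have D0 := S'_amp_den_gt0 (ltW s0).
rewrite /= andbT; apply/andP; split; last first.
  apply: xcoord_gt0_of_image C _.
  have : 0 <= (d - 1) * (d * s * S'_amp s).
    apply: mulr_ge0; first by rewrite subr_ge0 ltW.
    exact/ltW/mulr_gt0/A0/mulr_gt0.
  by lra.
rewrite xcoord_vec2 divr_gt0 //.
rewrite (_ : _ + _ = d ^+ 2 - S'_amp s * ((d - 1) * s + d ^+ 2)); last by ring.
rewrite subr_gt0 /S'_amp mulrAC ltr_pdivrMr // -subr_gt0.
rewrite (_ : _ - _ = s); last by ring.
by [].
Qed.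

(** * Traces and determinants *)

(** No [lam^-k] term appears: the LR map sends the unstable eigenvector to a
    multiple of the stable one. *)
Lemma trace_S k : \tr (Mword params (word_S k)) =
  - ((1 + d) / (d ^+ 2 + 1)) * lam ^+ k.
Proof.
have l0 := lt0r_neq0 (exprn_gt0 k lam_gt0).
rewrite /word_S Mword_cat Mword_RLR_pow /Mword /= mulmx1.
rewrite !AmxE /saddle_mx /= /fpt_den !mul_mx2 trace_mx2.
by move: l0; move: (lam ^+ k) => s l0; field; rewrite ?nz ?l0.
Qed.

Lemma trace_S' k : \tr (Mword params (word_S' k)) =
  (d ^+ 2 + d + 1) / lam ^+ k - d * lam ^+ k.
Proof.
have l0 := lt0r_neq0 (exprn_gt0 k lam_gt0).
rewrite /word_S' Mword_cat Mword_RLR_pow /Mword /= mulmx1.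
rewrite !AmxE /saddle_mx /= /fpt_den !mul_mx2 trace_mx2.
by move: l0; move: (lam ^+ k) => s l0; field; rewrite ?nz ?l0.
Qed.

Lemma det_saddle_mx s : s != 0 -> \det (saddle_mx s) = 1.
Proof.
by move=> s0; rewrite det_mx2 /fpt_den; field; rewrite ?nz ?s0.
Qed.

Lemma det_Amx J : \det (Amx params J) = delta params J.
Proof. by rewrite AmxE det_mx2; ring. Qed.

Lemma det_S k : \det (Mword params (word_S k)) = 1 / d.
Proof.
have l0 := lt0r_neq0 (exprn_gt0 k lam_gt0).
rewrite /word_S Mword_cat Mword_RLR_pow det_mulmx det_saddle_mx // mulr1.
by rewrite /Mword /= mulmx1 det_mulmx !det_Amx /=; field; rewrite ?nz.
Qed.

Lemma det_S' k : \det (Mword params (word_S' k)) = d ^+ 2.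
Proof.
have l0 := lt0r_neq0 (exprn_gt0 k lam_gt0).
rewrite /word_S' Mword_cat Mword_RLR_pow det_mulmx det_saddle_mx // mulr1.
by rewrite /Mword /= mulmx1 det_mulmx !det_Amx.
Qed.

End TunedMap.

(** * The two closed orbits *)

Section Conclusion.
Context {R : realType}.
Variable d : R.
Hypothesis d1 : 1 < d.

Let P := params d.
Let d0 : 0 < d := d_gt0 d1.
Let l0 : 0 < lam d := lam_gt0 d1.

Lemma lamX_bounds k : 0 < lam d ^+ k <= 1.
Proof.
by rewrite exprn_gt0 // exprn_ile1 ?ltW // (lt_trans (lam_lt_half d1)) //; lra.
Qed.

Lemma lamX_le_lam k : (1 <= k)%N -> 0 < lam d ^+ k <= lam d.
Proof.
case: k => // k _; have /andP[p0 p1] := lamX_bounds k.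
by rewrite exprS mulr_gt0 //= ger_pMr.
Qed.

Lemma lamX_split j k : (j < k)%N ->
  lam d ^+ k = lam d * (lam d ^+ j * lam d ^+ (k - j.+1)).
Proof. by move=> jk; rewrite mulrA -exprS -exprD subnKC. Qed.

Lemma S_orbit k : (1 <= k)%N -> let s := lam d ^+ k in
  let z := saddle_pt d (- S_amp d s) (- S_amp d s * (s / lam d)) in
  follow P (word_S k) z = z /\ strict_orbit P (word_S k) z.
Proof.
move=> k1 s z.
have /andP[s0 sl] := lamX_le_lam k1.
have s1 : s < 1 by have := lam_lt_half d1; rewrite /s; lra.
have sE : - S_amp d s * (s / lam d) / s = - S_amp d s / lam d.
  move: (lt0r_neq0 s0) (lt0r_neq0 l0); rewrite -/s; move: (lam d) => l sn ln.
  by field; rewrite ln sn.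
have zE : follow P (wpow k RLR) z =
    saddle_pt d (s * - S_amp d s) (- S_amp d s / lam d).
  by rewrite /z follow_RLR_pow // -/s sE.
split; first by rewrite /word_S follow_cat zE; exact: S_closed.
rewrite /word_S strict_orbit_cat zE S_tail_strict ?s0 // andbT.
apply: strict_orbit_RLR_pow => // j jk.
have sj := lamX_split jk; rewrite -/s in sj.
have /andP[p0 _] := lamX_bounds j.
have -> : - S_amp d s * (s / lam d) / lam d ^+ j =
    lam d ^+ (k - j.+1) * - S_amp d s.
  rewrite {2}sj; move: (lt0r_neq0 p0) (lt0r_neq0 l0).
  move: (S_amp d s) (lam d) (lam d ^+ (k - j.+1)) (lam d ^+ j) => A l q p pn ln.
  by field; rewrite pn ln.
by rewrite sj; apply: S_block_strict => //; exact: lamX_bounds.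
Qed.

Lemma S'_orbit k : (1 <= k)%N -> let s := lam d ^+ k in
  let z := saddle_pt d (- S'_amp d s) (d * s * - S'_amp d s) in
  follow P (word_S' k) z = z /\ strict_orbit P (word_S' k) z.
Proof.
move=> k1 s z.
have /andP[s0 _] := lamX_le_lam k1.
have A0 := S'_amp_gt0 d1 (ltW s0); have A1 := S'_amp_lt1 d1 s0.
have zE : follow P (wpow k RLR) z =
    saddle_pt d (s * - S'_amp d s) (d * - S'_amp d s).
  rewrite /z follow_RLR_pow // -/s; congr (saddle_pt _ _ _).
  by field; rewrite (lt0r_neq0 s0).
split; first by rewrite /word_S' follow_cat zE; exact: S'_closed.
rewrite /word_S' strict_orbit_cat zE S'_tail_strict // andbT.
apply: strict_orbit_RLR_pow => // j jk.
have /andP[p0 p1] := lamX_bounds j.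
have -> : d * s * - S'_amp d s / lam d ^+ j =
    d * lam d ^+ (k - j) * - S'_amp d s.
  rewrite /s -{1}(subnKC (ltnW jk)) exprD.
  move: (lt0r_neq0 p0); move: (lam d ^+ j) (lam d ^+ (k - j)) => p q pn.
  by field.
apply: S'_block_strict => //; rewrite ?A0 ?A1 ?p0 ?p1 //.
by apply: lamX_le_lam; rewrite subn_gt0.
Qed.

Lemma trace_S_lt0 k : \tr (Mword P (word_S k)) < 0.
Proof.
rewrite trace_S // mulNr oppr_lt0; apply: mulr_gt0; last exact: exprn_gt0.
by rewrite divr_gt0 ?addr_gt0 ?exprn_gt0.
Qed.

Lemma trace_S_sqr k :
  \tr (Mword P (word_S k)) ^+ 2 < 4 * \det (Mword P (word_S k)).
Proof.
rewrite trace_S // det_S // mul1r.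
have /andP[s0 s1] := lamX_bounds k; have g0 := sqrd1_gt0 d1.
rewrite exprMn sqrrN.
apply: (@le_lt_trans _ _ (((1 + d) / (d ^+ 2 + 1)) ^+ 2)).
  rewrite ger_pMr; first by rewrite exprn_ile1 // ltW.
  by rewrite exprn_gt0 // divr_gt0 ?addr_gt0 ?exprn_gt0.
rewrite expr_div_n ltr_pdivrMr ?exprn_gt0 // mulrAC ltr_pdivlMr //.
have : 0 <= (d ^+ 2 + 1) * (d - 1) ^+ 2 by rewrite mulr_ge0 ?sqr_ge0 ?ltW.
have : 0 <= d * (d - 1) ^+ 2 by rewrite mulr_ge0 ?sqr_ge0 ?ltW.
have : 0 < (d ^+ 2 + 1) ^+ 2 by rewrite exprn_gt0.
by nra.
Qed.

Lemma det_S_lt1 k : \det (Mword P (word_S k)) < 1.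
Proof. by rewrite det_S // ltr_pdivrMr // mul1r. Qed.

Lemma trace_S'_gt k : (1 <= k)%N ->
  1 + \det (Mword P (word_S' k)) < \tr (Mword P (word_S' k)).
Proof.
move=> k1; rewrite trace_S' // det_S' //.
have /andP[s0 sl] := lamX_le_lam k1; have lh := lam_lt_half d1.
move: (lam d ^+ k) s0 sl => s s0 sl.
have s2 : s < 1 / 2 by exact: le_lt_trans lh.
have n0 : 0 < d ^+ 2 + d + 1 by rewrite !addr_gt0 // exprn_gt0.
have ns : 2 * (d ^+ 2 + d + 1) < (d ^+ 2 + d + 1) / s.
  by rewrite ltr_pdivlMr // mulrAC gtr_pMl //; lra.
have ds : d * s < d * (1 / 2) by rewrite ltr_pM2l.
have dd : 0 < d ^+ 2 by rewrite exprn_gt0.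
rewrite ltrBrDr; by apply: lt_trans ns; have := d0; lra.
Qed.

End Conclusion.

Theorem theorem6p1 (R : realType) (dR : R) (hdR : 1 < dR)
    (k : nat) (hk : (1 <= k)%N) :
  let P := {|
    tauL := -1 + 1 / dR - 1 / (dR ^+ 2 * (dR ^+ 2 + 1));
    deltaL := 1 / dR ^+ 2;
    tauR := -1 - dR;
    deltaR := dR;
    mu := 1 |} in
  (exists p : {ffun 'I_(size (word_S k)) -> 'cV[R]_2},
     [/\ unique (is_cycle P (w := word_S k)) p,
         admissible p
       & asymptotically_stable P p]) /\
  (exists p : {ffun 'I_(size (word_S' k)) -> 'cV[R]_2},
     [/\ unique (is_cycle P (w := word_S' k)) p,
         admissible p
       & saddle_type P (word_S' k)]).
Proof.
move=> P; rewrite -/(params dR) in P *.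
have D0 : 0 < \det (Mword P (word_S k)) by rewrite det_S // divr_gt0 // d_gt0.
have D0' : 0 < \det (Mword P (word_S' k)).
  by rewrite det_S' // exprn_gt0 // d_gt0.
split.
- have [closed strict] := S_orbit hdR hk.
  have [p [p_cycle p_side]] := cycle_of_closed_orbit closed strict.
  have w0 : (0 < size (word_S k))%N by rewrite size_cat addn2.
  exists p; split.
  + apply: cycle_unique => //; apply: lt0r_neq0.
    by have := trace_S_lt0 hdR k; rewrite -/P; lra.
  + exact: admissible_strict.
  + apply: cycle_asymptotically_stable => //; first exact: trace_S_sqr.
    exact: det_S_lt1.
- have [closed strict] := S'_orbit hdR hk.
  have [p [p_cycle p_side]] := cycle_of_closed_orbit closed strict.
  have w0 : (0 < size (word_S' k))%N by rewrite size_cat addn2.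
  have T0 := trace_S'_gt hdR hk.
  exists p; split.
  + apply: cycle_unique => //; apply: ltr0_neq0.
    by rewrite -/P in T0; lra.
  + exact: admissible_strict.
  + by apply: saddle_type_of_trace.
Qed.
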